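(* For every $\lambda\in\mathbb{N}$ and every admissible function $f:\mathbb{N}\to\mathbb{N}$, the set $$\mathfrak{E}_{\lambda,f}=\Big\{x\in[0,1)\setminus\mathbb{Q}:\ \lim_{n\to\infty}\frac{L_n(x,\lambda)}{f(n)}=1\ \text{ and, for all } n\in\mathbb{N} \text{ and all } \mu\in\mathbb{N}\setminus\{\lambda\},\ L_n(x,\lambda)>L_n(x,\mu)\Big\}$$ has Hausdorff dimension $\dim \mathfrak{E}_{\lambda,f}=1$.
   Context: $\mathbb{N}=\{1,2,3,\dots\}$, and $\dim$ denotes Hausdorff dimension. Every $x\in[0,1)\setminus\mathbb{Q}$ has a unique continued fraction expansion $x=[a_1,a_2,a_3,\dots]=\cfrac{1}{a_1+\cfrac{1}{a_2+\cfrac{1}{a_3+\cdots}}}$ with partial quotients $a_n=a_n(x)\in\mathbb{N}$. For $n\in\mathbb{N}$, $x\in[0,1)\setminus\mathbb{Q}$ and $\lambda\in\mathbb{N}$, the fixed-symbol longest-run function is $L_n(x,\lambda)=\max_{0\le j\le n-1}\sum_{k=1}^{n-j}\prod_{i=1}^{k}\mathbf{1}_{a_{j+i}(x)=\lambda}\in\mathbb{N}\cup\{0\}$; equivalently, $L_n(x,\lambda)$ is the maximum length of a consecutive run of the value $\lambda$ among the first $n$ partial quotients $a_1(x),\dots,a_n(x)$ (equal to $0$ if $\lambda$ does not occur). A function $f:\mathbb{N}\to\mathbb{N}$ is called admissible if it is non-decreasing, unbounded, and $\lim_{n\to\infty}\frac{f(n+f(n))}{f(n)}=1$. *)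

(* Defs.v *)
From mathcomp Require Import all_boot all_order all_algebra.
From mathcomp Require Import all_classical all_reals all_analysis.

Set Implicit Arguments.
Unset Strict Implicit.
Unset Printing Implicit Defensive.

Import Order.TTheory GRing.Theory Num.Theory.
Import numFieldNormedType.Exports.

Local Open Scope classical_set_scope.
Local Open Scope ring_scope.

(* The supremum over the empty set is -oo, so [diameter set0 = -oo]. *)
Definition diameter (R : realType) (A : set R) : \bar R :=
  ereal_sup [set `|x - y|%:E | x in A & y in A].

(* The empty set has gauge 0 for every s, including s = 0, where [poweR]
   would give 1. *)
Definition hausdorff_gauge (R : realType) (s : R) (A : set R) : \bar R :=
  if A == set0 then 0%E else poweR (diameter A) s.

(* Finite covers are included, by padding with empty sets. *)
Definition hausdorff_content (R : realType) (s delta : R) (A : set R) :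
    \bar R :=
  ereal_inf [set (\sum_(0 <= i <oo) hausdorff_gauge s (U i))%E |
    U in [set U : nat -> set R |
      A `<=` \bigcup_i U i /\
      forall i, (diameter (U i) <= delta%:E)%E]].

Definition hausdorff_measure (R : realType) (s : R) (A : set R) : \bar R :=
  ereal_sup [set hausdorff_content s delta A |
    delta in [set delta : R | 0 < delta]].

Definition hausdorff_dim (R : realType) (A : set R) : \bar R :=
  ereal_inf [set s%:E | s in
    [set s : R | 0 <= s /\ hausdorff_measure s A = 0%E]].

(* [cfrac R [:: b1; ...; bn]] is 1 / (b1 + 1 / (... + 1 / bn)). *)
Definition cfrac (R : realType) (s : seq nat) : R :=
  foldr (fun b y => (b%:R + y)^-1) 0 s.

(* Sequences are indexed from 0 here: [a n] is the (n+1)-st partial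
   quotient. *)
Definition is_cf_expansion (R : realType) (x : R) (a : nat -> nat) : Prop :=
  (forall n, (0 < a n)%N) /\
  (cfrac R (mkseq a n) @[n --> \oo] --> x).

(* [partial_quotient x n] is a_n(x) for n >= 1 and irrational x in [0, 1[,
   where the expansion exists and is unique; it is junk elsewhere. *)
Definition partial_quotient (R : realType) (x : R) (n : nat) : nat :=
  xget (fun=> 0%N) [set a | is_cf_expansion x a] n.-1.

(* The booleans are coerced to their indicator values in nat. *)
Definition longest_run (R : realType) (n : nat) (x : R) (lambda : nat) : nat :=
  (\max_(0 <= j < n) \sum_(1 <= k < (n - j).+1)
     \prod_(1 <= i < k.+1) (partial_quotient x (j + i) == lambda))%N.

(* Functions on the positive integers are functions on nat whose value at 0 is
   ignored. *)
Definition admissible (R : realType) (f : nat -> nat) : Prop :=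
  [/\ forall n, (0 < n)%N -> (0 < f n)%N,
      forall m n, (0 < m)%N -> (m <= n)%N -> (f m <= f n)%N,
      forall M, exists2 n, (0 < n)%N & (M < f n)%N &
      ((f (n + f n)%N)%:R / (f n)%:R : R) @[n --> \oo] --> (1 : R)].

Definition longest_run_set (R : realType) (lambda : nat) (f : nat -> nat) :
    set R :=
  [set x : R | [/\ 0 <= x < 1,
    irrational x,
    ((longest_run n x lambda)%:R / (f n)%:R : R) @[n --> \oo] --> (1 : R) &
    forall n mu, (0 < n)%N -> (0 < mu)%N -> mu <> lambda ->
      (longest_run n x mu < longest_run n x lambda)%N]].

(* Main.v *)
Require Import Defs.
From mathcomp Require Import all_boot all_order all_algebra.
From mathcomp Require Import all_classical all_reals all_analysis.
From mathcomp Require Import ring lra zify.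

Set Implicit Arguments.
Unset Strict Implicit.
Unset Printing Implicit Defensive.

Import Order.TTheory GRing.Theory Num.Theory.
Import numFieldNormedType.Exports.

Local Open Scope classical_set_scope.
Local Open Scope ring_scope.

(** Upper bound: for s > 1 the unit interval, cut into m equal parts, has gauge
m^(1 - s), which tends to 0; hence every subset of it has dimension at most 1.

Lower bound: fix s < 1. The points are built by prescribing some of the partial
quotients and letting each of the others range freely over 1, ..., M.

Dimension of such a set. On the tree of admissible prefixes, distribute a unit
mass by splitting the mass of a prefix among its admissible extensions in
proportion to the lengths of their cylinders. At a free position the children
1, ..., M miss at most the proportion 2/(M+2) of the cylinder, so the ratio of mass
to length grows at most by the factor 1 + 2/M; at a forced position it grows at
most by a constant depending on M. As cylinders shrink at least by the factor 2
at every digit, a large M and a small enough density of forced positions keep the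
mass of every cylinder below a multiple of its length to the power t, for a
chosen t in ]s, 1[ ([cylinder_weight_powR]). Because digits are bounded, two
points that part company inside a cylinder are at a distance comparable with its
length ([cf_value_separated]). A mass distribution principle on trees
([mass_distribution]) then bounds the s-dimensional measure away from 0. Its
proof is a greedy descent: if the masses of countably many cylinders add up to
less than 1, some child always keeps more mass than the cylinders take from it,
and following such children produces a point outside all of them.

Choice of the prescribed positions ([run_pattern]). Start with a run of lambda of
length N; then, at every multiple of N, put a symbol different from lambda, and
lambda at the position after it. No other symbol can then have a run of length N,
so lambda leads from the first position on. After position start, cut the
positions into stages [n_k, n_(k+1)[ with n_(k+1) = n_k + G f(n_k), and fill the
last f(n_k) positions of each with lambda. The blocks have density at most 1/G,
the separators 2/N. The longest run of lambda up to n is at least f(n_k) once the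
stage of n_k is over and at most f(n) + 3N, the separators keeping the blocks
apart. Admissibility, iterated G times, gives f(n_(k+1)) ~ f(n_k) for fixed G,
so the longest run is asymptotic to f(n). *)

(** * Continuants and cylinders *)

Section Cylinders.
Context {R : realType}.
Implicit Types (w : seq nat) (a b : nat) (u v : R).

(** The denominators q_n and q_(n-1) of the last two convergents. *)
Definition continuants w : R * R :=
  foldl (fun q b => (b%:R * q.1 + q.2, q.1)) (1, 0) w.

(** The inverse branch of the iterated Gauss map that prepends the digits w; at 0
it is the convergent with digits w. *)
Definition cf_branch w u : R := foldr (fun b y => (b%:R + y)^-1) u w.

(** The distance between the images of 0 and 1 under [cf_branch w]. *)
Definition cylinder_length w : R :=
  ((continuants w).1 * ((continuants w).1 + (continuants w).2))^-1.

Lemma continuants_rcons w a :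
  continuants (rcons w a) =
  (a%:R * (continuants w).1 + (continuants w).2, (continuants w).1).
Proof. by rewrite /continuants foldl_rcons. Qed.

Lemma continuants_bounds w : all (leq 1) w ->
  [/\ 0 < (continuants w).1, 0 <= (continuants w).2
    & (continuants w).2 <= (continuants w).1].
Proof.
elim/last_ind: w => [|w a IH]; first by rewrite /= ltr01 lexx ler01.
rewrite all_rcons continuants_rcons /= => /andP[a1 /IH[q0 r0 rq]].
have a1R : 1 <= a%:R :> R by rewrite ler1n.
by split; nra.
Qed.

(** A branch is the homography (p_n + u p_(n-1)) / (q_n + u q_(n-1)), of
determinant 1 or -1; only its denominators matter here, and the induction on the
last digit needs no numerators. *)
Lemma cf_branchB w u v : all (leq 1) w -> 0 <= u -> 0 <= v ->
  `|cf_branch w u - cf_branch w v| =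
  `|u - v| / (((continuants w).1 + u * (continuants w).2)
            * ((continuants w).1 + v * (continuants w).2)).
Proof.
elim/last_ind: w u v => [|w a IH] u v.
  by rewrite /= !mulr0 !addr0 mulr1 divr1.
rewrite all_rcons => /andP[a1 w1] u0 v0.
have a1R : 1 <= a%:R :> R by rewrite ler1n.
rewrite /cf_branch !foldr_rcons -!/(cf_branch _ _) IH // ?invr_ge0; try lra.
have [q0 r0 rq] := continuants_bounds w1.
rewrite continuants_rcons /=; set q := (_).1 in q0 rq *; set r := (_).2 in r0 rq *.
have au : 0 < a%:R + u by lra.
have av : 0 < a%:R + v by lra.
have -> : (a%:R + u)^-1 - (a%:R + v)^-1 = (v - u) / ((a%:R + u) * (a%:R + v)).
  by field; rewrite !gt_eqF.
rewrite normrM normfV (ger0_norm (ltW (mulr_gt0 au av))) distrC.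
field; rewrite ?(gt_eqF au) ?(gt_eqF av) /=.
by apply/andP; split; rewrite gt_eqF//; nra.
Qed.

Lemma cylinder_length_gt0 w : all (leq 1) w -> 0 < cylinder_length w.
Proof. by move=> /continuants_bounds[q0 r0 _]; rewrite invr_gt0; nra. Qed.

Lemma cf_branchB_le w u v : all (leq 1) w -> 0 <= u <= 1 -> 0 <= v <= 1 ->
  `|cf_branch w u - cf_branch w v| <= 2 * cylinder_length w.
Proof.
move=> w1 /andP[u0 u1] /andP[v0 v1]; rewrite cf_branchB//.
have [q0 r0 rq] := continuants_bounds w1.
rewrite /cylinder_length; set q := (_).1 in q0 rq *; set r := (_).2 in r0 rq *.
rewrite ler_pdivrMr ?mulr_gt0//; try nra.
rewrite mulrAC ler_pdivlMr; last by nra.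
have uv : `|u - v| <= 1 by rewrite ler_norml; lra.
have uv0 : 0 <= `|u - v| by [].
have uq : q <= q + u * r by nra.
have vq : q <= q + v * r by nra.
have : q * q <= (q + u * r) * (q + v * r) by apply: ler_pM => //; lra.
have : `|u - v| * (q * (q + r)) <= 1 * (q * (q + q)).
  by apply: ler_pM => //; nra.
lra.
Qed.

Lemma cf_branchB_ge w u v : all (leq 1) w -> 0 <= u <= 1 -> 0 <= v <= 1 ->
  `|u - v| * cylinder_length w <= 2 * `|cf_branch w u - cf_branch w v|.
Proof.
move=> w1 /andP[u0 u1] /andP[v0 v1]; rewrite cf_branchB//.
have [q0 r0 rq] := continuants_bounds w1.
rewrite /cylinder_length; set q := (_).1 in q0 rq *; set r := (_).2 in r0 rq *.
rewrite ler_pdivrMr; last by nra.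
rewrite mulrA mulrAC ler_pdivlMr; last by apply: mulr_gt0; nra.
have uv0 : 0 <= `|u - v| by [].
have uq : q + u * r <= q + r by nra.
have vq : q + v * r <= q + r by nra.
have : (q + u * r) * (q + v * r) <= (q + r) * (q + r) by apply: ler_pM => //; nra.
move=> h.
have : `|u - v| * ((q + u * r) * (q + v * r)) <= `|u - v| * (2 * (q * (q + r))).
  by rewrite ler_wpM2l//; nra.
lra.
Qed.

(** The proportion of a cylinder occupied by its child of digit a, in terms of the
continuants (q, r) of the parent. *)
Definition cylinder_ratio (q r : R) a : R :=
  q * (q + r) / ((a%:R * q + r) * (a.+1%:R * q + r)).

Lemma cylinder_length_rcons w a : all (leq 1) w -> (0 < a)%N ->
  cylinder_length (rcons w a) = cylinder_length w *
    cylinder_ratio (continuants w).1 (continuants w).2 a.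
Proof.
move=> w1 a1; have [q0 r0 rq] := continuants_bounds w1.
have a1R : 1 <= a%:R :> R by rewrite ler1n.
rewrite /cylinder_length continuants_rcons /cylinder_ratio /=.
set q := (_).1 in q0 rq *; set r := (_).2 in r0 rq *.
by rewrite -(natr1 a); field; rewrite !gt_eqF//; nra.
Qed.

Lemma cylinder_length_rcons_le w a : all (leq 1) w -> (0 < a)%N ->
  cylinder_length (rcons w a) <= cylinder_length w / 2.
Proof.
move=> w1 a1; have [q0 r0 rq] := continuants_bounds w1.
rewrite cylinder_length_rcons// ler_pM2l ?cylinder_length_gt0//.
have a1R : 1 <= a%:R :> R by rewrite ler1n.
rewrite /cylinder_ratio; set q := (_).1 in q0 rq *; set r := (_).2 in r0 rq *.
rewrite -(natr1 a).
have h1 : q + r <= a%:R * q + r by nra.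
have h2 : 2 * q <= (a%:R + 1) * q + r by nra.
have h3 : (q + r) * (2 * q) <= (a%:R * q + r) * ((a%:R + 1) * q + r).
  by apply: ler_pM => //; nra.
by rewrite ler_pdivrMr; [lra|apply: mulr_gt0; nra].
Qed.

Lemma cylinder_length_rcons_ge w a : all (leq 1) w -> (0 < a)%N ->
  cylinder_length w <=
  (a.+1 * a.+2)%:R * cylinder_length (rcons w a).
Proof.
move=> w1 a1; have [q0 r0 rq] := continuants_bounds w1.
rewrite cylinder_length_rcons// mulrCA ler_peMr ?(ltW (cylinder_length_gt0 w1))//.
have a1R : 1 <= a%:R :> R by rewrite ler1n.
rewrite /cylinder_ratio; set q := (_).1 in q0 rq *; set r := (_).2 in r0 rq *.
rewrite natrM -(natr1 a.+1) -(natr1 a).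
have h1 : a%:R * q + r <= (a%:R + 1) * q by nra.
have h2 : (a%:R + 1) * q + r <= (a%:R + 1 + 1) * q by nra.
have h3 : (a%:R * q + r) * ((a%:R + 1) * q + r) <=
  ((a%:R + 1) * q) * ((a%:R + 1 + 1) * q) by apply: ler_pM => //; nra.
rewrite [X in 1 <= X]mulrA ler_pdivlMr; last by apply: mulr_gt0; nra.
rewrite mul1r; apply: (le_trans h3).
have -> : (a%:R + 1) * q * ((a%:R + 1 + 1) * q) =
  (a%:R + 1) * (a%:R + 1 + 1) * (q * q) by ring.
by apply: ler_wpM2l; nra.
Qed.

(** The ratio is (q + r) (1/(aq + r) - 1/((a+1)q + r)), so the sum telescopes. *)
Lemma sum_cylinder_ratio (q r : R) M : 0 < q -> 0 <= r ->
  \sum_(1 <= b < M.+1) cylinder_ratio q r b = M%:R * q / (M.+1%:R * q + r).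
Proof.
move=> q0 r0; elim: M => [|M IH]; first by rewrite big_geq// !mul0r.
rewrite big_nat_recr //= IH /cylinder_ratio.
rewrite -(natr1 M.+1) -(natr1 M).
have M0 : 0 <= M%:R :> R by [].
by field; rewrite !gt_eqF//; nra.
Qed.

(** The children of digit above M occupy little room: the loss at a free digit is
as small as desired when M is large. *)
Lemma sum_cylinder_length_rcons w M : all (leq 1) w -> (0 < M)%N ->
  cylinder_length w <=
  (1 + 2 / M%:R) * \sum_(1 <= b < M.+1) cylinder_length (rcons w b).
Proof.
move=> w1 M1; have [q0 r0 rq] := continuants_bounds w1.
have M1R : 1 <= M%:R :> R by rewrite ler1n.
under eq_big_nat => b /andP[b1 _] do rewrite cylinder_length_rcons//.
rewrite -mulr_sumr mulrCA ler_peMr ?(ltW (cylinder_length_gt0 w1))//.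
rewrite sum_cylinder_ratio//.
set q := (_).1 in q0 rq *; set r := (_).2 in r0 rq *.
rewrite -(natr1 M) mulrA ler_pdivlMr; last by nra.
have -> : (1 + 2 / M%:R) * (M%:R * q) = (M%:R + 2) * q.
  by field; rewrite gt_eqF//; lra.
by rewrite mul1r; nra.
Qed.

Lemma cylinder_length_le w : all (leq 1) w ->
  cylinder_length w <= 2^-1 ^+ size w.
Proof.
elim/last_ind: w => [|w a IH]; first by rewrite /cylinder_length /= addr0 mulr1 invr1 expr0.
rewrite all_rcons size_rcons => /andP[a1 w1].
apply: le_trans (cylinder_length_rcons_le w1 a1) _.
by rewrite exprSr ler_pM2r// IH.
Qed.

End Cylinders.

(** * Values of infinite continued fractions *)

Section Expansions.
Context {R : realType}.
Implicit Types (a b : nat -> nat) (x : R).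

Definition cf_value a : R := lim (cfrac R (mkseq a n) @[n --> \oo]).

Lemma cf_branch01 w (u : R) : all (leq 1) w -> 0 <= u <= 1 ->
  0 <= cf_branch w u <= 1.
Proof.
move=> w1 u01; elim: w w1 => //= b w IH /andP[b1 /IH /andP[c0 c1]].
have b1R : 1 <= b%:R :> R by rewrite ler1n.
rewrite invr_ge0 invf_le1; lra.
Qed.

Lemma all_mkseq_gt0 a n : (forall k, (0 < a k)%N) -> all (leq 1) (mkseq a n).
Proof. by move=> a0; apply/allP => _ /mapP[k _ ->]. Qed.

Lemma mkseqD a n m :
  mkseq a (n + m) = mkseq a n ++ mkseq (fun k => a (n + k)%N) m.
Proof.
rewrite /mkseq iotaD map_cat add0n; congr (_ ++ _).
by rewrite -{1}(addn0 n) iotaDl -map_comp.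
Qed.

Lemma mkseq_cons a n : mkseq a n.+1 = a 0%N :: mkseq (fun k => a k.+1) n.
Proof. by rewrite /mkseq /= -[1%N](addn0 1%N) iotaDl -map_comp. Qed.

Lemma cf_value_expansion a : (forall n, (0 < a n)%N) ->
  is_cf_expansion (cf_value a) a.
Proof.
move=> a0; split => //.
apply: cauchy_cvg; apply: cauchy_exP => e e0.
have [n _ hn] : \forall n \near \oo, `|2 * 2^-1 ^+ n| < e :> R.
  have /cvgrPdist_lt/(_ _ e0) : (2 * 2^-1 ^+ n : R) @[n --> \oo] --> (0 : R).
    apply: (@cvg_geometric R 2 2^-1).
    by rewrite ger0_norm ?invr_ge0// invf_lt1// ltr1n.
  by apply: filterS => n; rewrite sub0r normrN.
exists (cfrac R (mkseq a n)), n => // m /= nm.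
rewrite -ball_normE /= -(subnKC nm) mkseqD /cfrac foldr_cat.
apply: le_lt_trans (hn n (leqnn n)).
apply: le_trans (cf_branchB_le (all_mkseq_gt0 _ a0) _ _) _.
- by rewrite lexx ler01.
- by apply: cf_branch01; rewrite ?lexx ?ler01//; exact: all_mkseq_gt0.
rewrite ger0_norm ?mulr_ge0 ?exprn_ge0 ?invr_ge0// ler_pM2l//.
by apply: le_trans (cylinder_length_le _) _; rewrite ?size_mkseq//; exact: all_mkseq_gt0.
Qed.

Lemma cf_expansion_value a x : is_cf_expansion x a -> x = cf_value a.
Proof. by case=> _ /cvg_lim <-. Qed.

Lemma cf_value01 a : (forall n, (0 < a n)%N) -> 0 <= cf_value a <= 1.
Proof.
move=> a0; have [_ cva] := cf_value_expansion a0.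
have c01 n : 0 <= cfrac R (mkseq a n) <= 1.
  by apply: cf_branch01; rewrite ?lexx ?ler01//; exact: all_mkseq_gt0.
apply/andP; split.
  by apply: limr_ge; [exact: cvgP cva|apply: nearW => n; case/andP: (c01 n)].
by apply: limr_le; [exact: cvgP cva|apply: nearW => n; case/andP: (c01 n)].
Qed.

Lemma cf_valueS a : (forall n, (0 < a n)%N) ->
  cf_value a = ((a 0%N)%:R + cf_value (fun n => a n.+1))^-1.
Proof.
move=> a0; have a0' n : (0 < a n.+1)%N by [].
have [_ cva'] := cf_value_expansion a0'.
have [_ cva] := cf_value_expansion a0.
have /andP[v0 _] := cf_value01 a0'.
apply: (norm_cvg_unique cva).
suff : cfrac R (mkseq a n) @[n --> \oo] -->
  ((a 0%N)%:R + cf_value (fun n => a n.+1))^-1 by [].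
rewrite -(cvg_shiftS (fun n => cfrac R (mkseq a n))) /=.
rewrite (_ : (fun n => _) =
  (fun n => ((a 0)%:R + cfrac R (mkseq (fun n => a n.+1) n))^-1)); last first.
  by apply/funext => n; rewrite -[LHS]/(cfrac R (mkseq a n.+1)) mkseq_cons.
apply: cvgV; first by rewrite gt_eqF// ltr_wpDr// ltr0n.
by apply: cvgD; [exact: cvg_cst|].
Qed.

Lemma cf_value_gt0 a : (forall n, (0 < a n)%N) -> 0 < cf_value a.
Proof.
move=> a0; rewrite cf_valueS// invr_gt0 ltr_wpDr ?ltr0n//.
by have /andP[] := @cf_value01 (fun n => a n.+1) (fun n => a0 _).
Qed.

Lemma cf_value_lt1 a : (forall n, (0 < a n)%N) -> cf_value a < 1.
Proof.
move=> a0; have := @cf_value_gt0 (fun n => a n.+1) (fun n => a0 _).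
have : 1 <= (a 0%N)%:R :> R by rewrite ler1n.
by move=> ? ?; rewrite cf_valueS// invf_lt1; lra.
Qed.

Lemma cf_value_branch a n : (forall k, (0 < a k)%N) ->
  cf_value a = cf_branch (mkseq a n) (cf_value (fun k => a (n + k)%N)).
Proof.
elim: n a => [|n IH] a a0; first by congr cf_value; apply/funext.
rewrite cf_valueS// IH //.
by rewrite mkseq_cons.
Qed.

(** The first partial quotient is the integer part of the inverse of the value,
because the remainder lies strictly between 0 and 1. *)
Lemma cf_value_head a b : (forall n, (0 < a n)%N) -> (forall n, (0 < b n)%N) ->
  cf_value a = cf_value b -> a 0%N = b 0%N.
Proof.
move=> a0 b0; rewrite cf_valueS// [RHS]cf_valueS// => /invr_inj.
have ? := @cf_value_gt0 (fun n => a n.+1) (fun n => a0 _).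
have ? := @cf_value_gt0 (fun n => b n.+1) (fun n => b0 _).
have ? := @cf_value_lt1 (fun n => a n.+1) (fun n => a0 _).
have ? := @cf_value_lt1 (fun n => b n.+1) (fun n => b0 _).
move=> e; apply/eqP; rewrite eqn_leq -ltnS -[X in _ && X]ltnS -!(ltr_nat R) -!natr1.
by apply/andP; split; lra.
Qed.

Lemma cf_value_inj : {in [set a | forall n, (0 < a n)%N] &, injective cf_value}.
Proof.
move=> a b; rewrite !inE => a0 b0 ab; apply/funext => n.
elim: n a b a0 b0 ab => [|n IH] a b a0 b0 ab; first exact: cf_value_head.
apply: (IH (fun n => a n.+1) (fun n => b n.+1)) => //.
have := cf_value_head a0 b0 ab; move: ab.
by rewrite cf_valueS// [RHS]cf_valueS// => /invr_inj /[swap] -> /addrI.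
Qed.

Lemma partial_quotient_cf_value a n : (forall k, (0 < a k)%N) ->
  partial_quotient (cf_value a) n = a n.-1.
Proof.
move=> a0; rewrite /partial_quotient (@xget_unique _ _ _ a)//.
  exact: cf_value_expansion.
move=> b eb; apply/esym/cf_value_inj; rewrite ?inE//; first by case: eb.
exact: cf_expansion_value.
Qed.

(** Descent on the denominator: if the value is p/q, then 0 < p < q and the
remainder after the first digit is a fraction of denominator p. *)
Lemma cf_value_neq_frac (q p : nat) a : (forall n, (0 < a n)%N) ->
  cf_value a <> p%:R / q%:R.
Proof.
elim/ltn_ind: q p a => q IH p a a0 e.
have v0 := cf_value_gt0 a0; have v1 := cf_value_lt1 a0.
have q0 : (0 < q)%N by case: q {IH} e => // e; move: v0; rewrite e invr0 mulr0 ltxx.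
have qR : 0 < q%:R :> R by rewrite ltr0n.
have p0R : 0 < p%:R :> R by move: v0; rewrite e pmulr_lgt0// invr_gt0.
have pq : (p < q)%N by move: v1; rewrite e ltr_pdivrMr// mul1r ltr_nat.
pose a' n := a n.+1.
have w0 : 0 < cf_value a' by apply: cf_value_gt0 => n; exact: a0.
have ea : cf_value a' = q%:R / p%:R - (a 0%N)%:R.
  apply/eqP; rewrite eq_sym subr_eq addrC -(invrK (_ + cf_value a')) -cf_valueS// e.
  by rewrite invf_div.
apply: (IH p pq (q - a 0 * p)%N a') => // [n|]; first exact: a0.
have e2 : cf_value a' * p%:R = q%:R - (a 0%N)%:R * p%:R.
  by rewrite ea; field; rewrite gt_eqF.
rewrite natrB ?natrM.
  by apply/eqP; rewrite -e2 mulfK// gt_eqF.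
by rewrite -(ler_nat R) natrM -subr_ge0 -e2 mulr_ge0// ltW.
Qed.

Lemma cf_value_irrational a : (forall n, (0 < a n)%N) ->
  irrational (cf_value a).
Proof.
move=> a0; rewrite /irrational /= => /rationalP[z [q e]].
have v0 := cf_value_gt0 a0.
case: z e => [p|p]; first exact: cf_value_neq_frac.
rewrite NegzE mulrNz => e; move: v0; rewrite e.
by rewrite mulNr oppr_gt0 ltNge mulr_ge0// invr_ge0.
Qed.

End Expansions.

(** * Mass distribution on trees *)

Section MassDistribution.
Context {R : realType}.
Variables (A : nat -> seq nat) (p : seq nat -> R).
Hypothesis A_uniq : forall n, uniq (A n).
Hypothesis p_ge0 : forall w, 0 <= p w.
Hypothesis p_nil : p [::] = 1.
Hypothesis p_split : forall w, p w = \sum_(a <- A (size w)) p (rcons w a).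
Implicit Types (u w : seq nat) (d : nat -> nat).

(** The mass of the intersection of the cylinders w and u. *)
Definition mass_meet w u : R :=
  if prefix w u then p u else if prefix u w then p w else 0.

Lemma mass_meet_ge0 w u : 0 <= mass_meet w u.
Proof. by rewrite /mass_meet; case: ifP => // _; case: ifP. Qed.

(** Only an inequality, since w may leave the tree below u: then no child of u
meets the cylinder w. *)
Lemma sum_mass_meet w u :
  \sum_(a <- A (size u)) mass_meet w (rcons u a) <= mass_meet w u.
Proof.
rewrite /mass_meet; case: ifPn => [wu|wNu].
  rewrite [leRHS]p_split; apply: ler_sum => a _.
  by rewrite (prefix_trans wu (prefix_rcons _ _)).
have key a : prefix w (rcons u a) -> w = rcons u a.
  move/prefixP => [t]; case/lastP: t => [|t b]; first by rewrite cats0.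
  rewrite -rcons_cat => /rcons_inj[e _]; move: wNu.
  by rewrite e prefix_prefix.
case: ifPn => [uw|uNw]; last first.
  rewrite big1// => a _; case: ifPn => [/key e|_].
    by move: uNw; rewrite e prefix_rcons.
  by case: ifPn => // h; rewrite (prefix_trans (prefix_rcons u a) h) in uNw.
have /prefixP[[|b t] ew] := uw; first by move: wNu; rewrite ew cats0 prefix_refl.
have bound a : (if prefix w (rcons u a) then p (rcons u a)
  else if prefix (rcons u a) w then p w else 0) <= (if a == b then p w else 0).
  case: ifPn => [/key e|_].
    have : rcons u a = rcons u b ++ t by rewrite cat_rcons -ew.
    rewrite -e {1}e; case/lastP: t {ew} => [|t c].
      by rewrite cats0 => /rcons_inj[->]; rewrite eqxx.
    move/(congr1 size); rewrite size_cat !size_rcons; lia.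
  case: ifPn => [/prefixP[t' e]|_]; last by case: ifP.
  move: e; rewrite ew cat_rcons => /eqP; rewrite eqseq_cat// eqxx /= => /eqP[-> _].
  by rewrite eqxx.
apply: le_trans (ler_sum _ (fun a _ => bound a)) _.
case: (boolP (b \in A (size u))) => [bA|bA].
  by rewrite (bigD1_seq b)//= eqxx big1 ?addr0// => a /negPf->.
by rewrite big1_seq// => a /andP[_ ab]; case: eqP => // eab; rewrite -eab ab in bA.
Qed.

(** A prefix is kept good, in that the cylinders W i take less than its whole mass;
a good prefix has a good child by additivity. A prefix equal to some W i is never
good. *)
Lemma avoid_cylinders (W : nat -> seq nat) :
  (\sum_(0 <= i <oo) (p (W i))%:E < 1)%E ->
  exists2 d, (forall n, d n \in A n) &
    forall i, mkseq d (size (W i)) <> W i.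
Proof.
move=> W1.
pose S u : \bar R := (\sum_(0 <= i <oo) (mass_meet (W i) u)%:E)%E.
have S0 u i : (0 <= (mass_meet (W i) u)%:E)%E by rewrite lee_fin mass_meet_ge0.
have Snil : (S [::] < (p [::])%:E)%E.
  rewrite p_nil; apply: le_lt_trans W1; apply: lee_nneseries => // i _.
  rewrite lee_fin /mass_meet prefix0s; case: ifPn => //.
  by case: (W i).
have step u : (S u < (p u)%:E)%E ->
    exists2 a, a \in A (size u) & (S (rcons u a) < (p (rcons u a))%:E)%E.
  move=> Su; apply: contrapT => noa.
  have : ((p u)%:E <= S u)%E; last by rewrite leNgt Su.
  rewrite p_split -sumEFin.
  apply: (@le_trans _ _ (\sum_(a <- A (size u)) S (rcons u a))%E).
    rewrite !big_seq; apply: lee_sum => a aA; rewrite leNgt; apply/negP => Sa.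
    by apply: noa; exists a.
  rewrite /S -nneseries_sum//; apply: lee_nneseries => [i _ _|i _].
    by apply: sume_ge0.
  by rewrite sumEFin lee_fin sum_mass_meet.
pose good u := (S u < (p u)%:E)%E.
have child u : exists a, good u -> a \in A (size u) /\ good (rcons u a).
  case: (pselect (good u)) => [/step[a aA ga]|ng]; first by exists a.
  by exists 0%N.
have [next nextP] := boolp.choice child.
pose path := fix path n :=
  if n is m.+1 then rcons (path m) (next (path m)) else [::].
have pathP n : good (path n) /\ size (path n) = n.
  elim: n => [|n [gn sn]]; first by [].
  by rewrite /= size_rcons sn; split=> //; case: (nextP _ gn).
pose d n := next (path n).
have mkd n : mkseq d n = path n by elim: n => // n IH; rewrite mkseqS IH.
exists d => [n|i].
  by have [gn sn] := pathP n; have [] := nextP _ gn; rewrite sn.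
set n := size (W i); rewrite mkd => e.
have [+ _] := pathP n; rewrite /good ltNge => /negP; apply.
apply: le_trans (_ : ((mass_meet (W i) (path n))%:E <= _)%E).
  by rewrite e /mass_meet prefix_refl.
rewrite /S (nneseriesD1 (n := i))//.
by rewrite leeDl// nneseries_ge0.
Qed.

Hypothesis A_neq0 : forall n, A n != [::].

(** A cover U of E yields cylinders: the points of the tree mapped into U i share
a longest common prefix, beyond which two of them split, so its mass is at most a
multiple of the gauge of U i. When at most one point is mapped into U i there is no
splitting, and a long prefix of arbitrarily small mass serves instead; this costs
only a small total error. The cylinders obtained contain the whole tree, so their
masses add up to at least 1. *)
Theorem mass_distribution (h : (nat -> nat) -> R) (E : set R) (s C : R) :
  0 <= s -> 0 <= C ->
  (forall d, (forall n, d n \in A n) -> E (h d)) ->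
  (forall d (e : R), (forall n, d n \in A n) -> 0 < e ->
    exists n, p (mkseq d n) <= e) ->
  (forall d d' n, (forall n, d n \in A n) -> (forall n, d' n \in A n) ->
    (forall k, (k < n)%N -> d k = d' k) -> d n <> d' n ->
    p (mkseq d n) <= C * `|h d - h d'| `^ s) ->
  hausdorff_measure s E <> 0%E.
Proof.
move=> s0 C0 hE psmall psep H0.
(* A cover of gauge below gamma would give cylinders of total mass at most
  1/4, plus an error 1/4. *)
pose gamma := (4 * (C + 1))^-1.
have gamma0 : 0 < gamma by rewrite invr_gt0; lra.
have Cgamma : C * gamma <= 4^-1.
  by rewrite /gamma ler_pdivrMr; lra.
have : (hausdorff_content s 1 E < gamma%:E)%E.
  apply: (@le_lt_trans _ _ 0%E); last by rewrite lte_fin.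
  by rewrite -H0; apply: ereal_sup_ubound; exists 1 => //=; exact: ltr01.
move=> /ereal_inf_lt[_ [U [EU _] <-]] Ug.
have gauge0 i : (0 <= hausdorff_gauge s (U i))%E.
  by rewrite /hausdorff_gauge; case: ifP => // _; exact: poweR_ge0.
pose e i : R := 4^-1 / (2 ^ i.+1)%:R.
have e0 i : 0 < e i by rewrite divr_gt0// ltr0n expn_gt0.
have covered i : exists w, (forall d, (forall n, d n \in A n) -> U i (h d) ->
    mkseq d (size w) = w) /\
    ((p w)%:E <= C%:E * hausdorff_gauge s (U i) + (e i)%:E)%E.
  have small w : p w <= e i ->
      ((p w)%:E <= C%:E * hausdorff_gauge s (U i) + (e i)%:E)%E.
    move=> pw; apply: (@le_trans _ _ (e i)%:E); first by rewrite lee_fin.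
    by rewrite leeDr// mule_ge0 ?lee_fin.
  pose B : set (nat -> nat) := [set d | (forall n, d n \in A n) /\ U i (h d)].
  have [[d [dA dU]]|B0] := pselect (exists d, B d); last first.
    have dA n : head 0%N (A n) \in A n.
      by have := A_neq0 n; case: (A n) => //= a l _; rewrite mem_head.
    have [n pn] := psmall _ _ dA (e0 i).
    exists (mkseq (fun n => head 0%N (A n)) n); split; last exact: small.
    by move=> d dB dU; case: B0; exists d.
  have [[n0 split0]|same] := pselect (exists n, exists2 d', B d' & d' n <> d n);
      last first.
    have [n pn] := psmall _ _ dA (e0 i).
    exists (mkseq d n); split; last exact: small.
    move=> d' d'A d'U; rewrite size_mkseq; apply: eq_map => k.
    by apply: contrapT => kd; apply: same; exists k, d'.
  (* The first position where some point mapped into U i leaves d. *)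
  have ex : exists n, `[<exists2 d', B d' & d' n <> d n>] by exists n0; apply/asboolP.
  case: (ex_minnP ex) => n /asboolP[d' [d'A d'U] dn] nmin.
  have agree d1 : B d1 -> forall k, (k < n)%N -> d1 k = d k.
    move=> B1 k kn; apply: contrapT => dk.
    have /nmin : `[<exists2 d', B d' & d' k <> d k>] by apply/asboolP; exists d1.
    by rewrite leqNgt kn.
  exists (mkseq d n); split.
    move=> d1 d1A d1U; rewrite size_mkseq; apply/eq_in_map => k.
    by rewrite mem_iota /= add0n => kn; apply: agree.
  apply: (@le_trans _ _ (C%:E * hausdorff_gauge s (U i))%E); last first.
    by rewrite leeDl// lee_fin ltW.
  have Une : U i != set0 by apply/set0P; exists (h d).
  rewrite /hausdorff_gauge (negbTE Une).
  have pd : p (mkseq d n) <= C * `|h d - h d'| `^ s.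
    by apply: psep => // [k kn|/esym//]; apply/esym/agree.
  apply: (@le_trans _ _ (C%:E * (`|h d - h d'| `^ s)%:E)%E).
    by rewrite -EFinM lee_fin.
  rewrite lee_wpmul2l ?lee_fin// -poweR_EFin.
  have dist_diam : (`|h d - h d'|%:E <= diameter (U i))%E.
    by apply: ereal_sup_ubound => /=; exists (h d) => //; exists (h d').
  apply: gt0_ler_poweR => //; rewrite in_itv /= leey andbT ?lee_fin//.
  by apply: le_trans dist_diam; rewrite lee_fin.
have [W WP] := boolp.choice covered.
have : (\sum_(0 <= i <oo) (p (W i))%:E < 1)%E.
  apply: (@le_lt_trans _ _ (\sum_(0 <= i <oo)
     (C%:E * hausdorff_gauge s (U i) + (e i)%:E))%E).
    by apply: lee_nneseries => [i _ _|i _]; [rewrite lee_fin|case: (WP i)].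
  apply: le_lt_trans (epsilon_trick _ _ _) _ => //.
    by move=> i; rewrite mule_ge0 ?lee_fin.
  rewrite nneseriesZl//.
  apply: (@le_lt_trans _ _ (4^-1 + 4^-1)%:E); last by rewrite lte_fin; lra.
  rewrite EFinD leeD2r//; apply: le_trans (_ : ((C * gamma)%:E <= _)%E).
    by rewrite EFinM lee_wpmul2l ?lee_fin// ltW.
  by rewrite lee_fin.
move=> /avoid_cylinders[d dA dW].
have [i _ Ui] := EU _ (hE _ dA).
by apply: (dW i); case: (WP i) => + _; exact.
Qed.

End MassDistribution.

(** * Digits that are prescribed or bounded *)

Section RestrictedDigits.
Context {R : realType}.
Implicit Types (c d : nat -> nat) (w : seq nat) (M n : nat).

(** The value 0, which is no partial quotient, marks the free positions of c. *)
Definition allowed_digits c M n : seq nat :=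
  if c n == 0%N then index_iota 1 M.+1 else [:: c n].

Definition forced_count c n : nat := (\sum_(0 <= i < n) (c i != 0))%N.

(** The mass of w when each prefix shares its mass among its allowed extensions in
proportion to the lengths of their cylinders. *)
Definition cylinder_weight c M w : R :=
  \prod_(i < size w) (cylinder_length (take i.+1 w) /
    \sum_(b <- allowed_digits c M i) cylinder_length (rcons (take i w) b)).

Lemma cylinder_weight_rcons c M w a :
  cylinder_weight c M (rcons w a) = cylinder_weight c M w *
  (cylinder_length (rcons w a) /
    \sum_(b <- allowed_digits c M (size w)) cylinder_length (rcons w b)).
Proof.
rewrite /cylinder_weight size_rcons big_ord_recr /=; congr (_ * _).
  apply: eq_bigr => i _; rewrite -cats1 !takel_cat// ltnW//.
by rewrite take_oversize ?size_rcons// -cats1 take_size_cat.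
Qed.

(** Digits 0 are permitted here: the additivity of the weight is needed for all
words, also those outside the tree. *)
Lemma continuants_ge0 w : [/\ 0 <= (continuants w).1 :> R,
  0 <= (continuants w).2 :> R & 0 < (continuants w).1 + (continuants w).2 :> R].
Proof.
elim/last_ind: w => [|w a [q0 r0 qr0]]; first by rewrite /= addr0 lexx ler01 ltr01.
rewrite continuants_rcons /=; case: a => [|a]; first by rewrite mul0r add0r addrC.
have a1 : 1 <= a.+1%:R :> R by rewrite ler1n.
by split; nra.
Qed.

Lemma cylinder_length_ge0 w : 0 <= cylinder_length w :> R.
Proof. by have [q0 r0 qr0] := continuants_ge0 w; rewrite invr_ge0; nra. Qed.

Lemma cylinder_length_rcons_gt0 w a : (0 < a)%N ->
  0 < cylinder_length (rcons w a) :> R.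
Proof.
move=> a0; have [q0 r0 qr0] := continuants_ge0 w.
have a1 : 1 <= a%:R :> R by rewrite ler1n.
rewrite invr_gt0 continuants_rcons /=.
by apply: mulr_gt0; nra.
Qed.

Lemma cylinder_weight_ge0 c M w : 0 <= cylinder_weight c M w.
Proof.
apply: prodr_ge0 => i _; rewrite divr_ge0 ?sumr_ge0// => *;
  exact: cylinder_length_ge0.
Qed.

Lemma allowed_digits_gt0 c M n a : a \in allowed_digits c M n -> (0 < a)%N.
Proof.
rewrite /allowed_digits; case: eqP => [_|/eqP cn].
  by rewrite mem_index_iota => /andP[].
by rewrite inE => /eqP->; rewrite lt0n.
Qed.

Lemma allowed_digits_le c M n a : (c n <= M)%N ->
  a \in allowed_digits c M n -> (a <= M)%N.
Proof.
rewrite /allowed_digits; case: eqP => [_ _|/eqP cn ?].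
  by rewrite mem_index_iota => /andP[].
by rewrite inE => /eqP->.
Qed.

Lemma allowed_digits_neq0 c M n : (0 < M)%N -> allowed_digits c M n != [::].
Proof.
move=> M0; rewrite /allowed_digits; case: ifP => // _.
by rewrite -size_eq0 size_iota subn1 -lt0n.
Qed.

Lemma sum_allowed_gt0 c M n w : (0 < M)%N ->
  0 < \sum_(b <- allowed_digits c M n) cylinder_length (rcons w b) :> R.
Proof.
move=> M0; have := @allowed_digits_gt0 c M n.
have := allowed_digits_neq0 c n M0.
case: (allowed_digits c M n) => // a s _ as0.
rewrite big_cons ltr_pwDl//.
  by apply: cylinder_length_rcons_gt0; apply: as0; rewrite mem_head.
by rewrite sumr_ge0// => *; exact: cylinder_length_ge0.
Qed.

Lemma cylinder_weight_split c M w : (0 < M)%N ->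
  cylinder_weight c M w =
  \sum_(a <- allowed_digits c M (size w)) cylinder_weight c M (rcons w a).
Proof.
move=> M0; under eq_bigr do rewrite cylinder_weight_rcons.
by rewrite -mulr_sumr -mulr_suml mulfV ?mulr1// gt_eqF// sum_allowed_gt0.
Qed.

(** One factor bounds the growth of the ratio of weight to length at each digit,
the other one its additional growth at the forced digits. *)
Lemma cylinder_weight_le c M d n : (0 < M)%N -> (forall k, (c k <= M)%N) ->
  (forall k, d k \in allowed_digits c M k) ->
  cylinder_weight c M (mkseq d n) <= cylinder_length (mkseq d n) *
    ((1 + 2 / M%:R) ^+ n * (M.+1 * M.+2)%:R ^+ forced_count c n).
Proof.
move=> M0 cM dA; have d0 k : (0 < d k)%N by exact: allowed_digits_gt0 (dA k).
have free1 : 1 <= 1 + 2 / M%:R :> R by rewrite lerDl divr_ge0.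
elim: n => [|n IH].
  rewrite /cylinder_weight /forced_count big_ord0 big_geq// !expr0 !mulr1.
  by rewrite /cylinder_length /= addr0 mulr1 invr1.
rewrite mkseqS cylinder_weight_rcons size_mkseq; set w := mkseq d n in IH *.
have w1 : all (leq 1) w by exact: all_mkseq_gt0.
set S := \sum_(b <- _) _; set X := _ ^+ n * _ in IH.
have S0 : 0 < S by exact: sum_allowed_gt0.
have X0 : 0 <= X by rewrite mulr_ge0// exprn_ge0//; lra.
rewrite mulrCA ler_wpM2l ?cylinder_length_ge0// ler_pdivrMr//.
apply: le_trans IH _.
rewrite /forced_count big_nat_recr//= -/(forced_count c n).
have -> : (1 + 2 / M%:R) ^+ n.+1 *
    (M.+1 * M.+2)%:R ^+ (forced_count c n + (c n != 0%N)) * S =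
    ((1 + 2 / M%:R) * (M.+1 * M.+2)%:R ^+ (c n != 0%N) * S) * X :> R.
  by rewrite /X exprS exprD; ring.
rewrite ler_wpM2r// /S /allowed_digits; case: eqP => [_|/eqP cn] /=.
  by rewrite expr0 mulr1; exact: sum_cylinder_length_rcons.
rewrite expr1 big_seq1 -mulrA.
have l0 : 0 <= cylinder_length (rcons w (c n)) :> R by exact: cylinder_length_ge0.
have cn0 : (0 < c n)%N by rewrite lt0n.
apply: le_trans (cylinder_length_rcons_ge w1 cn0) _.
rewrite -[leLHS]mul1r; apply: ler_pM; rewrite ?ler01 ?mulr_ge0//.
by rewrite ler_wpM2r// ler_nat leq_mul ?ltnS.
Qed.

Lemma cf_value_ge_inv d M : (forall k, (0 < d k <= M)%N) ->
  M.+1%:R^-1 <= cf_value d :> R.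
Proof.
move=> dM; have d0 k : (0 < d k)%N by case/andP: (dM k).
rewrite cf_valueS// lef_pV2 ?posrE//; last first.
  by rewrite -invr_gt0 -cf_valueS// cf_value_gt0.
rewrite -natr1; apply: lerD; first by rewrite ler_nat; case/andP: (dM 0%N).
by have /andP[] := @cf_value01 R (fun n => d n.+1) (fun n => d0 _).
Qed.

(** Just after the common prefix the two tails are 1/(a + xi) and 1/(b + eta) with
a < b and remainders xi at most 1, eta at least 1/(M+1); so b + eta exceeds a + xi
by at least 1/(M+1), and both are at most M + 1. *)
Lemma cf_value_separated d d' M n :
  (forall k, (0 < d k <= M)%N) -> (forall k, (0 < d' k <= M)%N) ->
  (forall k, (k < n)%N -> d k = d' k) -> d n <> d' n ->
  cylinder_length (mkseq d n) <= 2 * M.+1%:R ^+ 3 * `|cf_value d - cf_value d'| :> R.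
Proof.
wlog dd : d d' / (d n < d' n)%N.
  move=> H dM d'M ag dn; have [lt|gt|//] := ltngtP (d n) (d' n); first exact: H.
  have -> : mkseq d n = mkseq d' n.
    by apply/eq_in_map => k; rewrite mem_iota add0n => /andP[_ /ag].
  by rewrite distrC; apply: H => // [k /ag//|/esym].
move=> dM d'M ag _.
have d0 k : (0 < d k)%N by case/andP: (dM k).
have d'0 k : (0 < d' k)%N by case/andP: (d'M k).
have e : mkseq d n = mkseq d' n.
  by apply/eq_in_map => k; rewrite mem_iota add0n => /andP[_ /ag].
rewrite (cf_value_branch n d0) (cf_value_branch n d'0) -e.
set u := cf_value _; set v := cf_value _.
have w1 : all (leq 1) (mkseq d n) by exact: all_mkseq_gt0.
have u01 : 0 <= u <= 1 by apply: cf_value01 => k.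
have v01 : 0 <= v <= 1 by apply: cf_value01 => k.
have := cf_branchB_ge w1 u01 v01.
set l := cylinder_length _; set D := `|cf_branch _ _ - _| => uvl.
have l0 : 0 <= l by exact: cylinder_length_ge0.
set T : R := M.+1%:R.
have T1 : 1 <= T by rewrite ler1n.
suff : 1 <= T ^+ 3 * `|u - v|.
  move=> h; have : l * 1 <= l * (T ^+ 3 * `|u - v|) by rewrite ler_wpM2l.
  have : T ^+ 3 * (`|u - v| * l) <= T ^+ 3 * (2 * D).
    by apply: ler_wpM2l => //; apply: exprn_ge0; lra.
  lra.
rewrite /u /v cf_valueS// [X in _ - X]cf_valueS// !addn0.
set xi := cf_value _; set eta := cf_value _.
have /andP[xi0 xi1] : 0 <= xi <= 1 by apply: cf_value01 => k.
have /andP[eta0 eta1] : 0 <= eta <= 1 by apply: cf_value01 => k.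
have etaT : T^-1 <= eta by apply: cf_value_ge_inv => k.
have dn1 : 1 <= (d n)%:R :> R by rewrite ler1n.
have ddR : (d n)%:R + 1 <= (d' n)%:R :> R by rewrite natr1 ler_nat.
have d'T : (d' n)%:R + 1 <= T by rewrite natr1 ler_nat ltnS; case/andP: (d'M n).
have a0 : 0 < (d n)%:R + xi by lra.
have b0 : 0 < (d' n)%:R + eta by lra.
have -> : ((d n)%:R + xi)^-1 - ((d' n)%:R + eta)^-1 =
    ((d' n)%:R + eta - ((d n)%:R + xi)) / (((d n)%:R + xi) * ((d' n)%:R + eta)).
  by field; rewrite !gt_eqF.
clearbody T xi eta.
have gap : T^-1 <= (d' n)%:R + eta - ((d n)%:R + xi) by lra.
have T0 : 0 < T^-1 by rewrite invr_gt0; lra.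
rewrite ger0_norm; last first.
  by apply: divr_ge0; [lra|apply: mulr_ge0; lra].
rewrite mulrA ler_pdivlMr ?mulr_gt0// mul1r.
have h1 : ((d n)%:R + xi) * ((d' n)%:R + eta) <= T * T.
  by apply: ler_pM; lra.
apply: (le_trans h1).
have -> : T * T = T ^+ 3 * T^-1 by rewrite exprSr mulfK ?expr2// gt_eqF//; lra.
by apply: ler_wpM2l => //; apply: exprn_ge0; lra.
Qed.

Lemma exists_expr_le (z e : R) : 0 <= z < 1 -> 0 < e -> exists n, z ^+ n <= e.
Proof.
move=> /andP[z0 z1] e0.
have : (1 * z ^+ n : R) @[n --> \oo] --> (0 : R).
  by apply: (@cvg_geometric R 1 z); rewrite ger0_norm.
move=> /cvgrPdist_lt/(_ _ e0)[n _ /(_ n (leqnn n))] /=.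
rewrite sub0r normrN mul1r ger0_norm ?exprn_ge0// => /ltW h; exists n; exact: h.
Qed.

(** With beta = 2^((1-t)/2), take M so large that a free digit costs at most the
factor beta, and G so large that a forced digit costs at most beta^G. The total
cost after n digits is then at most a multiple of beta^(2n) = 2^(n(1-t)), and the
length of the cylinder, at most 2^-n, pays for it with its power t - 1. The bound B
leaves room for the prescribed digits. *)
Lemma cylinder_weight_powR (t : R) (B : nat) : 0 < t < 1 ->
  exists M G, [/\ (0 < M)%N, (B <= M)%N, (1 < G)%N &
   forall c C, (forall k, (c k <= M)%N) ->
     (forall n, (G * forced_count c n <= n + C)%N) ->
     exists2 K, 0 <= K & forall d n, (forall k, d k \in allowed_digits c M k) ->
     cylinder_weight c M (mkseq d n) <= K * cylinder_length (mkseq d n) `^ t].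
Proof.
move=> /andP[t0 t1]; pose beta : R := 2 `^ ((1 - t) / 2).
have beta1 : 1 < beta.
  have : (1 : R) `^ ((1 - t) / 2) < beta.
    by apply: gt0_ltr_powR; rewrite ?nnegrE ?ltr1n//; lra.
  by rewrite powR1.
pose M := (maxn B (Num.Def.archi_bound (2 / (beta - 1)))).+1.
have bM : 1 + 2 / M%:R <= beta.
  rewrite -lerBrDl ler_pdivrMr// -ler_pdivrMl ?subr_gt0// mulrC.
  apply: le_trans (ltW (archi_boundP _)) _; first by rewrite divr_ge0// subr_ge0 ltW.
  by rewrite ler_nat leqW// leq_maxr.
pose kappa : R := (M.+1 * M.+2)%:R.
have kappa1 : 1 <= kappa by rewrite ler1n.
have [G0 hG0] : exists G, beta^-1 ^+ G <= kappa^-1.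
  apply: exists_expr_le; last by rewrite invr_gt0; lra.
  by rewrite invr_ge0 invf_lt1//; lra.
pose G := (G0 + 2)%N.
have hG : kappa <= beta ^+ G.
  apply: le_trans (_ : beta ^+ G0 <= _).
    by move: hG0; rewrite exprVn lef_pV2// posrE ?exprn_gt0//; lra.
  by apply: ler_weXn2l; rewrite ?leq_addr// ltW.
have BM : (B <= M)%N by rewrite leqW// leq_maxl.
have M0 : (0 < M)%N by [].
have G1 : (1 < G)%N by rewrite /G addn2.
exists M, G; split=> //; clearbody M G.
move=> c C cM fC; exists (beta ^+ C); first by rewrite exprn_ge0//; lra.
move=> d n dA; have d0 k : (0 < d k)%N by exact: allowed_digits_gt0 (dA k).
apply: le_trans (cylinder_weight_le n M0 cM dA) _.
set l := cylinder_length _; have l0 : 0 < l.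
  by apply: cylinder_length_gt0; exact: all_mkseq_gt0.
have l2 : l <= 2^-1 ^+ n.
  have := @cylinder_length_le R (mkseq d n) (all_mkseq_gt0 n d0).
  by rewrite size_mkseq.
clearbody l; have free : (1 + 2 / M%:R) ^+ n <= beta ^+ n.
  by rewrite lerXn2r// ?nnegrE ?(le_trans _ bM)// ?addr_ge0 ?divr_ge0//; lra.
have forced : kappa ^+ forced_count c n <= beta ^+ (n + C).
  apply: le_trans (_ : (beta ^+ G) ^+ forced_count c n <= _).
    by rewrite lerXn2r// ?nnegrE ?exprn_ge0//; lra.
  by rewrite -exprM; apply: ler_weXn2l; rewrite ?fC// ltW.
have powl : beta ^+ (n + n) <= l `^ (t - 1).
  have -> : beta ^+ (n + n) = (2 ^+ n) `^ (1 - t).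
    rewrite -powR_mulrn ?powR_ge0// -powRrM -[in RHS]powR_mulrn// -powRrM natrD.
    by congr (_ `^ _); field.
  have -> : l `^ (t - 1) = l^-1 `^ (1 - t).
    by rewrite -[l^-1]powR_inv1 ?ltW// -powRrM; congr (_ `^ _); ring.
  apply: ge0_ler_powR; rewrite ?nnegrE ?exprn_ge0 ?invr_ge0 ?(ltW l0)//; first lra.
  by rewrite -[2 ^+ n]invrK -exprVn lef_pV2// posrE exprn_gt0.
apply: (@le_trans _ _ (l * (beta ^+ n * beta ^+ (n + C)))).
  apply: ler_wpM2l; first exact: ltW.
  apply: ler_pM; [| |exact: free|exact: forced].
    by apply: exprn_ge0; rewrite addr_ge0// divr_ge0.
  by apply: exprn_ge0.
have -> : l `^ t = l * l `^ (t - 1) by rewrite mulr_powRB1// ltW.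
rewrite [leRHS]mulrCA; apply: ler_wpM2l; first exact: ltW.
rewrite exprD mulrA mulrC -exprD; apply: ler_wpM2l => //.
by apply: exprn_ge0; lra.
Qed.

End RestrictedDigits.

Section RestrictedDigitsDimension.
Context {R : realType}.

(** The weights are controlled with an exponent t strictly between s and 1, so that
they tend to 0 along each branch also when s = 0. *)
Theorem restricted_digits_measure_neq0 (s : R) (B : nat) : 0 <= s < 1 ->
  exists M G, [/\ (B <= M)%N, (1 < G)%N &
    forall c C (E : set R), (forall k, (c k <= M)%N) ->
      (forall n, (G * forced_count c n <= n + C)%N) ->
      (forall d, (forall k, d k \in allowed_digits c M k) -> E (cf_value d)) ->
      hausdorff_measure s E <> 0%E].
Proof.
move=> /andP[s0 s1]; pose t := (1 + s) / 2.
have t01 : 0 < t < 1 by rewrite /t; apply/andP; split; lra.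
have st : s <= t by rewrite /t; lra.
have [t0 t1] := andP t01.
clearbody t.
have [M [G [M0 BM G1 H]]] := cylinder_weight_powR B t01.
exists M, G; split=> // c C E cM fC EA.
have {H} [K K0 weightK] := H c C cM fC.
have digits d : (forall k, d k \in allowed_digits c M k) ->
    forall k, (0 < d k <= M)%N.
  move=> dA k; rewrite (allowed_digits_gt0 (dA k)).
  by rewrite (allowed_digits_le (cM k) (dA k)).
have pos d : (forall k, d k \in allowed_digits c M k) -> forall k, (0 < d k)%N.
  by move=> dA k; case/andP: (digits d dA k).
pose D : R := 2 * M.+1%:R ^+ 3.
have D0 : 0 <= D by rewrite mulr_ge0// exprn_ge0.
apply: (@mass_distribution R (allowed_digits c M) (cylinder_weight c M) _ _ _ _ _
  cf_value E s (K * D `^ s)) => //.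
- by move=> n; rewrite /allowed_digits; case: ifP => _ //; exact: iota_uniq.
- exact: cylinder_weight_ge0.
- by rewrite /cylinder_weight big_ord0.
- by move=> w; exact: cylinder_weight_split.
- by move=> n; exact: allowed_digits_neq0.
- by rewrite mulr_ge0// powR_ge0.
- move=> d e dA e0.
  have [n hn] : exists n, (2^-1 `^ t) ^+ n <= e / (K + 1).
    apply: exists_expr_le; last by rewrite divr_gt0//; lra.
    rewrite powR_ge0/=; have : (2^-1 : R) `^ t < 1 `^ t.
      by apply: gt0_ltr_powR; rewrite ?nnegrE ?invr_ge0// invf_lt1// ltr1n.
    by rewrite powR1.
  exists n; apply: le_trans (weightK d n dA) _.
  have l0 := @cylinder_length_gt0 R _ (all_mkseq_gt0 n (pos d dA)).
  have := @cylinder_length_le R _ (all_mkseq_gt0 n (pos d dA)).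
  rewrite size_mkseq; set l := cylinder_length _ in l0 * => l2.
  have : l `^ t <= e / (K + 1).
    apply: le_trans hn; rewrite -powR_mulrn ?powR_ge0// -powRrM [t * _]mulrC powRrM.
    rewrite powR_mulrn ?invr_ge0//.
    by apply: ge0_ler_powR => //; rewrite ?nnegrE; exact: ltW.
  rewrite ler_pdivlMr; last by lra.
  have : 0 <= l `^ t by exact: powR_ge0.
  nra.
move=> d d' n dA d'A ag dn.
apply: le_trans (weightK d n dA) _; rewrite -mulrA; apply: ler_wpM2l => //.
have w1 := all_mkseq_gt0 n (pos d dA).
have l0 := @cylinder_length_gt0 R _ w1.
have l1 : cylinder_length (mkseq d n) <= 1 :> R.
  apply: le_trans (cylinder_length_le w1) _.
  by rewrite exprn_ile1 ?invr_ge0// invf_le1// ler1n.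
have sep := @cf_value_separated R d d' M n (digits d dA) (digits d' d'A) ag dn.
apply: le_trans (_ : cylinder_length (mkseq d n) `^ s <= _).
  by apply: ger_powR => //; rewrite l0.
rewrite -powRM//; apply: ge0_ler_powR => //; rewrite ?nnegrE ?mulr_ge0//.
exact: ltW.
Qed.

End RestrictedDigitsDimension.

(** * Longest runs of a digit sequence *)

Section LongestRun.
Context {R : realType}.
Implicit Types (d : nat -> nat) (j l m n mu : nat).
Local Open Scope nat_scope.

Let indicator_prod_le1 (F : nat -> bool) r : \prod_(i <- r) (F i : nat) <= 1.
Proof.
elim: r => [|a r IH]; first by rewrite big_nil.
by rewrite big_cons; case: (F a); rewrite ?mul1n ?mul0n.
Qed.

Lemma longest_run_ge d j l n mu : (forall k, 0 < d k) ->
  (forall i, j <= i < j + l -> d i = mu) -> j + l <= n ->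
  l <= longest_run n (cf_value d : R) mu.
Proof.
move=> d0; case: l => // l run jn.
apply: leq_trans (leq_bigmax_seq j _ _); rewrite ?mem_index_iota//; try lia.
rewrite (@big_cat_nat _ _ _ l.+2)//=; last by lia.
apply: leq_trans (leq_addr _ _).
rewrite big_nat.
rewrite (eq_bigr (fun=> 1)) => [|k /andP[k1 kl]].
  by rewrite -big_nat sum_nat_const_nat muln1 subn1.
rewrite big_nat big1// => i /andP[i1 ik].
by rewrite partial_quotient_cf_value// run ?eqxx//; lia.
Qed.

Lemma longest_run_le d m n mu : (forall k, 0 < d k) ->
  (forall j, j + m < n -> exists2 i, j <= i <= j + m & d i <> mu) ->
  longest_run n (cf_value d : R) mu <= m.
Proof.
move=> d0 block; rewrite /longest_run; apply/bigmax_leqP_seq => j _ _.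
have le1 a b : \sum_(a <= k < b) \prod_(1 <= i < k.+1)
    (partial_quotient (cf_value d : R) (j + i) == mu : nat) <= b - a.
  apply: leq_trans (_ : \sum_(a <= k < b) 1 <= _).
    by apply: leq_sum => k _; exact: indicator_prod_le1.
  by rewrite sum_nat_const_nat muln1.
have [njm|mnj] := leqP (n - j) m.
  by apply: leq_trans (le1 _ _) _; rewrite subn1.
have [i /andP[ji im] di] := block j ltac:(lia).
rewrite (@big_cat_nat _ _ _ m.+1)//=; last by lia.
rewrite [X in _ + X]big_nat [X in _ + X]big1 => [|k /andP[mk kn]].
  by rewrite addn0; apply: leq_trans (le1 _ _) _; rewrite subn1.
(* The factor at the position i vanishes. *)
rewrite (bigD1_seq (i - j).+1) ?iota_uniq ?mem_index_iota//=; last by lia.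
rewrite partial_quotient_cf_value//.
by rewrite (_ : (j + (i - j).+1).-1 = i); [case: eqP|lia].
Qed.

End LongestRun.

(** * The positions of the prescribed digits *)

Section Residues.
Local Open Scope nat_scope.

Lemma count_residue N r n : r < N ->
  \sum_(0 <= i < n) (i %% N == r : nat) = n %/ N + (r < n %% N).
Proof.
move=> rN; have N0 : 0 < N by lia.
elim: n => [|n IH]; first by rewrite big_geq// div0n mod0n.
rewrite big_nat_recr//= IH divnS// modnS.
have := ltn_mod n N; rewrite N0.
case: ifPn => [dvd|_]; last by case: ltngtP => /=; lia.
have /dvdn_leq : N %| (n %% N).+1.
  by move: dvd; rewrite {1}(divn_eq n N) -addnS dvdn_addr// dvdn_mull.
by case: ltngtP; lia.
Qed.


Lemma residue_in_window N r x : r < N -> exists2 i, x <= i < x + N & i %% N = r.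
Proof.
move=> rN; have := divn_eq x N.
have : x %% N < N by rewrite ltn_mod; lia.
move: (x %% N) (x %/ N) => y q yN ->.
have [yr|ry] := leqP y r.
  by exists (q * N + r); [lia|rewrite modnMDl modn_small].
by exists (q.+1 * N + r); [lia|rewrite modnMDl modn_small].
Qed.


End Residues.

Section Pattern.
Variables (lambda : nat) (f : nat -> nat) (G start : nat).
Local Open Scope nat_scope.

Hypothesis f_gt0 : forall n, 0 < n -> 0 < f n.
Hypothesis G_gt1 : 1 < G.

Let N := 2 * G.
Hypothesis start_ge : N <= start.

Lemma period_gt1 : 1 < N.
Proof. by rewrite /N; lia. Qed.

Fixpoint stage k : nat :=
  if k is k'.+1 then stage k' + G * f (stage k') else start.

Definition in_block i : bool :=
  `[< exists k, stage k.+1 - f (stage k) <= i < stage k.+1 >].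

(** Any symbol other than lambda would do. *)
Definition separator : nat := if lambda == 1 then 2 else 1.

Definition run_pattern i : nat :=
  if (i < N) || in_block i then lambda
  else if i %% N == 0 then separator
  else if i %% N == 1 then lambda else 0.

Lemma stage_gt0 k : 0 < stage k.
Proof. by elim: k => /= [|k]; move: period_gt1; lia. Qed.

Lemma stage_homo : {homo stage : k l / k <= l}.
Proof. by apply: homo_leq => // [|k]; [exact: leq_trans|rewrite leq_addr]. Qed.

Lemma stage_lt k : stage k < stage k.+1.
Proof. by have := f_gt0 (stage_gt0 k); rewrite /=; nia. Qed.

Lemma stage_ge k : k <= stage k.
Proof. by elim: k => // k IH; apply: leq_ltn_trans IH (stage_lt k). Qed.

Lemma stage_exists i : start <= i -> exists k, stage k <= i < stage k.+1.
Proof.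
move=> si; have ex : exists k, i < stage k.+1 by exists i; exact: stage_ge.
case: (ex_minnP ex) => k ik kmin; exists k; rewrite ik andbT.
case: k {ik} kmin => [//|k] kmin; rewrite leqNgt; apply/negP => /kmin.
by rewrite ltnn.
Qed.

Lemma stage_uniq k l i :
  stage k <= i < stage k.+1 -> stage l <= i < stage l.+1 -> k = l.
Proof.
move=> /andP[ki ik] /andP[li il]; apply/eqP; rewrite eqn_leq.
by apply/andP; split; rewrite leqNgt; apply/negP => /stage_homo; lia.
Qed.

Lemma in_blockE k i : stage k <= i < stage k.+1 ->
  in_block i = (stage k.+1 - f (stage k) <= i).
Proof.
move=> ki; apply/asboolP/idP => [[l /andP[li il]]|h]; last first.
  by exists k; rewrite h; case/andP: ki.
suff -> : k = l by [].
apply: (stage_uniq ki); rewrite il andbT; apply: leq_trans li.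
by move: il; rewrite /=; have := f_gt0 (stage_gt0 l); nia.
Qed.

Lemma in_block_start i : i < start -> in_block i = false.
Proof.
move=> si; apply/asboolP => -[k /andP[ki _]].
have := stage_homo (leq0n k); move: ki; rewrite /=.
by have := f_gt0 (stage_gt0 k); nia.
Qed.

(** A block takes the last of the G equal parts of its stage, so that at no
moment do the blocks fill more than the G-th part of the positions. *)
Lemma count_in_block n : G * \sum_(0 <= i < n) (in_block i : nat) <= n.
Proof.
have small m : m <= start -> \sum_(0 <= i < m) (in_block i : nat) = 0.
  move=> ms; rewrite big_nat big1// => i /andP[_ im].
  by rewrite in_block_start// (leq_trans im).
have in_stage k m : stage k <= m <= stage k.+1 ->
    \sum_(stage k <= i < m) (in_block i : nat) <= m - (stage k.+1 - f (stage k)).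
  move=> /andP[km mk]; rewrite big_nat.
  rewrite (eq_bigr (fun i => (stage k.+1 - f (stage k) <= i : nat))); last first.
    by move=> i /andP[ki im]; rewrite (@in_blockE k)// ki (leq_trans im).
  rewrite -big_nat; elim: m km {mk} => [|m IH] km; first by rewrite big_geq.
  move: km; rewrite leq_eqVlt => /orP[/eqP<-|km]; first by rewrite big_geq.
  by rewrite big_nat_recr//=; have := IH km; case: leqP => /=; lia.
have partial k m : stage k <= m <= stage k.+1 ->
    G * \sum_(0 <= i < stage k) (in_block i : nat) <= stage k ->
    G * \sum_(0 <= i < m) (in_block i : nat) <= m.
  move=> km; rewrite (@big_cat_nat _ _ _ (stage k) _ m)//=; last by case/andP: km.
  have := in_stage k m km; move: km => /=.
  set x := (\sum_(0 <= i < stage k) _)%N; set y := (\sum_(stage k <= i < m) _)%N.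
  by clearbody x y; move: G_gt1; nia.
have whole k : G * \sum_(0 <= i < stage k) (in_block i : nat) <= stage k.
  elim: k => [|k IH]; first by rewrite small// muln0.
  by apply: partial IH; rewrite (ltnW (stage_lt k)) leqnn.
have [ns|sn] := leqP n start; first by rewrite small// muln0.
have [k /andP[kn nk]] := stage_exists (ltnW sn).
by apply: partial (whole k); rewrite kn ltnW.
Qed.

Lemma forced_count_run_pattern n :
  G * forced_count run_pattern n <= 2 * n + (G * N + N).
Proof.
have N1 := period_gt1.
have pointwise i : (run_pattern i != 0 : nat) <=
    (i < N) + in_block i + (i %% N == 0) + (i %% N == 1).
  rewrite /run_pattern; case: ifP => [/orP[]->|_].
  - by case: (lambda != 0) => /=; lia.
  - by case: (lambda != 0) => /=; lia.
  case: (i %% N == 0) => /=; first by case: (separator != 0) => /=; lia.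
  by case: (i %% N == 1) => //=; case: (lambda != 0) => /=; lia.
have init : \sum_(0 <= i < n) (i < N : nat) <= N.
  elim: n => [|n IH]; first by rewrite big_geq.
  have [nN|Nn] := leqP n.+1 N.
    apply: leq_trans (_ : \sum_(0 <= i < n.+1) 1 <= _).
      by apply: leq_sum => i _; case: ltnP.
    by rewrite sum_nat_const_nat muln1 subn0.
  by rewrite big_nat_recr//=; move: IH; case: ltnP => //; lia.
have : forced_count run_pattern n <= \sum_(0 <= i < n)
    ((i < N) + in_block i + (i %% N == 0) + (i %% N == 1)).
  by apply: leq_sum => i _; exact: pointwise.
rewrite !big_split /= !count_residue//; last by lia.
have := count_in_block n; have := leq_trunc_div n N.
move: init; set x := forced_count _ _.
set y := \sum_(0 <= i < n) (_ < N)%N; set z := \sum_(0 <= i < n) _; set q := n %/ N.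
clearbody x y z q.
by rewrite /N; do 2!case: (_ < n %% _) => /=; nia.
Qed.

Hypothesis f_homo : forall m n, 0 < m -> m <= n -> f m <= f n.
Hypothesis f_start : N <= f start.

Lemma f_stage_ge k : N <= f (stage k).
Proof.
apply: leq_trans f_start _; apply: f_homo; first by move: period_gt1; lia.
exact: (stage_homo (leq0n k)).
Qed.

(** Walking back from the end of the window, one reaches N consecutive positions
outside the blocks after at most f n + N steps: either at once, or just before the
last block met, whose length is at most f n and which is preceded by a gap of length
at least N. The initial run accounts for the remaining N. *)
Lemma separator_in_window j n : j + (f n + 3 * N) < n ->
  exists2 i, j <= i <= j + (f n + 3 * N) & run_pattern i = separator.
Proof.
set e := j + _ => en; have N1 := period_gt1.
suff [x [xj xN xe free]] : exists x, [/\ j <= x, N <= x, x + N <= e.+1 &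
    forall i, x <= i < x + N -> in_block i = false].
  have [i /andP[xi ix] i0] := residue_in_window x (ltnW N1).
  exists i; first lia.
  by rewrite /run_pattern free ?xi// i0 orbF ltnNge (leq_trans xN xi).
have before_block k : let b := stage k.+1 - f (stage k) in
    [/\ stage k + N <= b, b + f (stage k) = stage k.+1 &
     forall i, b - N <= i < b -> in_block i = false].
  have fN := f_stage_ge k; have sS : stage k.+1 = stage k + G * f (stage k) by [].
  have kb : stage k + N <= stage k.+1 - f (stage k) by rewrite sS; move: G_gt1; nia.
  split=> // [|i ib]; first by rewrite subnK// sS; move: G_gt1; nia.
  by rewrite (@in_blockE k); lia.
have f_le k : stage k <= n -> f (stage k) <= f n.
  by apply: f_homo; exact: stage_gt0.
have [es|se] := ltnP e start.
  exists (maxn j N); split; try lia.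
  by move=> i ?; rewrite in_block_start//; lia.
have [k /andP[ke ek]] := stage_exists se.
have [kb bS bfree] := before_block k.
have fk := f_le k ltac:(lia).
have [be|eb] := leqP (stage k.+1 - f (stage k)) e.
  by exists (stage k.+1 - f (stage k) - N); split; [lia|lia|lia|move=> i ?; apply: bfree; lia].
have stage_free i : stage k <= i <= e -> in_block i = false.
  by move=> ?; rewrite (@in_blockE k); lia.
have [kN|Nk] := leqP (stage k + N) e.+1.
  by exists (e.+1 - N); split; [lia|lia|lia|move=> i ?; apply: stage_free; lia].
case: k ke ek kb bS bfree fk eb stage_free Nk => [|k] ke ek kb bS bfree fk eb sf Nk.
  exists (e.+1 - N); split; [lia|lia|lia|move=> i ?].
  have [si|igt] := leqP start i; first by apply: sf; rewrite /=; lia.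
  exact: in_block_start.
have [kb' bS' bfree'] := before_block k.
have fk' := f_le k ltac:(have := stage_lt k; lia).
by exists (stage k.+1 - f (stage k) - N); split; [lia|lia|lia|move=> i ?; apply: bfree'; lia].
Qed.

End Pattern.

(** * Subsets of the unit interval have dimension at most 1 *)

Section UpperBound.
Context {R : realType}.

Lemma hausdorff_content_ge0 (s delta : R) (A : set R) :
  (0 <= hausdorff_content s delta A)%E.
Proof.
apply: le_ereal_inf_tmp => _ [U _ <-]; apply: nneseries_ge0 => i _ _.
by rewrite /hausdorff_gauge; case: ifP => // _; exact: poweR_ge0.
Qed.

Lemma diameter_itv_le (a b : R) : (diameter [set x | (a <= x <= b)%R] <= (b - a)%:E)%E.
Proof.
apply: ge_ereal_sup => _ [x /= /andP[ax xb] [y /= /andP[ay yb] <-]].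
by rewrite lee_fin ler_norml; lra.
Qed.

Lemma hausdorff_measure_eq0 (s : R) (A : set R) : 1 < s ->
  A `<=` [set x | 0 <= x <= 1] -> hausdorff_measure s A = 0%E.
Proof.
move=> s1 A01; apply/eqP; rewrite eq_le; apply/andP; split; last first.
  apply: le_trans (hausdorff_content_ge0 s 1 A) _.
  by apply: ereal_sup_ubound; exists 1 => //=; exact: ltr01.
apply: ge_ereal_sup => _ [delta /= delta0 <-].
apply/lee_addgt0Pr => e e0; rewrite add0e.
(* With more than bound parts, both the mesh h is below delta and the gauge
  h^(s-1) below e. *)
pose bound := delta^-1 + (e `^ (s - 1)^-1)^-1.
have e1 : 0 < e `^ (s - 1)^-1 by exact: powR_gt0.
have bound0 : 0 < bound by rewrite addr_gt0 ?invr_gt0.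
have [m m_bound] : exists m, bound <= m.+1%:R.
  exists (Num.Def.archi_bound bound).
  by apply: le_trans (ltW (archi_boundP (ltW bound0))) _; rewrite ler_nat.
pose h : R := m.+1%:R^-1.
have h0 : 0 < h by rewrite invr_gt0.
have h_delta : h <= delta.
  rewrite -[delta]invrK lef_pV2 ?posrE ?invr_gt0//; apply: le_trans m_bound.
  by rewrite lerDl invr_ge0 ltW.
have h_e : h `^ (s - 1) <= e.
  have -> : e = (e `^ (s - 1)^-1) `^ (s - 1).
    by rewrite -powRrM mulVf ?powRr1 ?ltW// gt_eqF// subr_gt0.
  apply: ge0_ler_powR; rewrite ?nnegrE ?(ltW h0) ?(ltW e1)//; first lra.
  rewrite -[leRHS]invrK lef_pV2 ?posrE ?invr_gt0//; apply: le_trans m_bound.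
  by rewrite lerDr invr_ge0 ltW.
pose U i : set R :=
  if (i < m.+1)%N then [set x | i%:R * h <= x <= i.+1%:R * h] else set0.
have diamU i : (diameter (U i) <= h%:E)%E.
  rewrite /U; case: ifP => _.
    apply: le_trans (diameter_itv_le _ _) _.
    by rewrite lee_fin -mulrBl -natrB ?leqnSn// subSnn mul1r.
  by apply: ge_ereal_sup => _ [x []].
apply: (@ge_ereal_inf _ _ e%:E); exists (\sum_(0 <= i <oo) hausdorff_gauge s (U i))%E.
  exists U => //; split=> [x /A01 /= /andP[x0 x1]|i]; last first.
    by apply: le_trans (diamU i) _; rewrite lee_fin.
  have [xlt1|x1'] := ltP x 1; last first.
    have -> : x = 1 by lra.
    exists m => //; rewrite /U ltnSn /= /h.
    by rewrite mulfV// lexx andbT ler_pdivrMr// mul1r ler_nat.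
  have xm0 : 0 <= x * m.+1%:R by rewrite mulr_ge0.
  exists (Num.trunc (x * m.+1%:R)) => //; rewrite /U.
  have /andP[t1 t2] := truncn_itv xm0.
  rewrite ifT /=; last first.
    rewrite -(ltr_nat R); apply: le_lt_trans t1 _.
    by rewrite gtr_pMl.
  by rewrite /h ler_pdivrMr// t1 ler_pdivlMr// ltW.
have gauge0 i : (0 <= hausdorff_gauge s (U i))%E.
  by rewrite /hausdorff_gauge; case: ifP => // _; exact: poweR_ge0.
rewrite (nneseries_split 0 m.+1)// add0n [X in (_ + X)%E]eseries0; last first.
  by move=> i mi _; rewrite /U ltnNge mi /= /hausdorff_gauge eqxx.
rewrite adde0.
apply: (@le_trans _ _ (\sum_(0 <= i < m.+1) (h `^ s)%:E)%E).
  apply: lee_sum => i _; rewrite /hausdorff_gauge; case: ifPn => [_|/set0P[x Ux]].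
    by rewrite lee_fin powR_ge0.
  rewrite -poweR_EFin; apply: gt0_ler_poweR; rewrite ?in_itv /= ?leey ?andbT//.
  - by lra.
  - apply: (@le_trans _ _ `|x - x|%:E); first by rewrite lee_fin.
    by apply: ereal_sup_ubound; exists x => //; exists x.
  - by rewrite lee_fin ltW.
rewrite sumEFin lee_fin sumr_const_nat subn0 -mulr_natr.
apply: le_trans h_e.
rewrite -[in leLHS](mulr_powRB1 (ltW h0)); last by lra.
by rewrite mulrAC /h mulVf ?mul1r.
Qed.

End UpperBound.

(** * The longest run is asymptotic to f *)

Section Assembly.
Context {R : realType}.

Lemma expr1D_le (x : R) m : 0 <= x <= 1 -> (1 + x) ^+ m <= 1 + 3 ^+ m * x.
Proof.
move=> /andP[x0 x1]; elim: m => [|m IH]; first by rewrite !expr0 mul1r lerDl.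
have p1 : 1 <= 3 ^+ m :> R by rewrite exprn_ege1// ler1n.
rewrite exprS; apply: (@le_trans _ _ ((1 + x) * (1 + 3 ^+ m * x))).
  by apply: ler_wpM2l => //; lra.
rewrite exprS; set p := 3 ^+ m in p1 *.
have px : x <= p * x by nra.
have pxx : p * x * x <= p * x by nra.
lra.
Qed.

Section PatternDigits.
Variables (lambda : nat) (f : nat -> nat) (G start : nat).
Hypothesis lambda_gt0 : (0 < lambda)%N.
Hypothesis f_adm : admissible R f.
Hypothesis G_gt1 : (1 < G)%N.
Let N := (2 * G)%N.
Hypothesis start_ge : (N <= start)%N.
Hypothesis f_start : (N <= f start)%N.

Variable d : nat -> nat.
Hypothesis d_gt0 : forall k, (0 < d k)%N.
Let c := run_pattern lambda f G start.
Hypothesis dE : forall k, c k <> 0%N -> d k = c k.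
Let x : R := cf_value d.

Let f_gt0 : forall n, (0 < n)%N -> (0 < f n)%N. Proof. by case: f_adm. Qed.
Let f_homo : forall m n, (0 < m)%N -> (m <= n)%N -> (f m <= f n)%N.
Proof. by case: f_adm. Qed.

Let st := stage f G start.

Lemma run_at_start i : (i < N)%N -> d i = lambda.
Proof. by move=> iN; rewrite dE /c /run_pattern iN//=; apply/eqP; rewrite -lt0n. Qed.

Lemma run_at_residue1 i : (i %% N = 1)%N -> d i = lambda.
Proof.
move=> i1; have : c i = lambda by rewrite /c /run_pattern -/N i1; case: ifP.
by move=> ci; rewrite dE ci//; apply/eqP; rewrite -lt0n.
Qed.

Lemma longest_run_stage_ge k n : (st k.+1 <= n)%N ->
  (f (st k) <= longest_run n x lambda)%N.
Proof.
move=> kn; have fS : (f (st k) <= st k.+1)%N.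
  by rewrite /st /=; move: G_gt1; nia.
apply: (@longest_run_ge R d (st k.+1 - f (st k))%N) => //; last by rewrite subnK.
move=> i; rewrite subnK// => ki.
have block : in_block f G start i by apply/asboolP; exists k.
by rewrite dE /c /run_pattern block orbT//; apply/eqP; rewrite -lt0n.
Qed.

Lemma longest_run_pattern_le n : (longest_run n x lambda <= f n + 3 * N)%N.
Proof.
apply: longest_run_le => // j jn.
have [i ij ci] := separator_in_window lambda f_gt0 G_gt1 start_ge
  f_homo f_start jn.
have s0 : separator lambda <> 0%N by rewrite /separator; case: ifP.
exists i => //; rewrite dE /c ci// /separator.
by case: eqP => [->//|/eqP]; rewrite eq_sym => /eqP.
Qed.

(** Other symbols cannot run past the positions congruent to 1 modulo N, while
the initial run already has length N. *)
Lemma longest_run_lt n mu : (0 < n)%N -> mu <> lambda ->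
  (longest_run n x mu < longest_run n x lambda)%N.
Proof.
move=> n0 ml; have N1 : (1 < N)%N by rewrite /N; lia.
have [nN|Nn] := leqP n N.
  have mu0 : (longest_run n x mu <= 0)%N.
    apply: longest_run_le => // j; rewrite addn0 => jn.
    by exists j; [lia|rewrite run_at_start; [exact/nesym|lia]].
  apply: leq_ltn_trans mu0 (leq_trans n0 _).
  by apply: (@longest_run_ge R d 0) => // i ?; apply: run_at_start; lia.
have lN : (N <= longest_run n x lambda)%N.
  by apply: (@longest_run_ge R d 0) => [//|i ?|]; [apply: run_at_start|]; lia.
apply: leq_trans lN; rewrite -(ltn_predK N1) ltnS.
apply: longest_run_le => // j jn.
have [i ij i1] := residue_in_window j N1.
by exists i; [lia|rewrite run_at_residue1//; exact/nesym].
Qed.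

(** For n in the stage after that of n_k, monotonicity bounds f n by f(n_(k+2)),
which two stages of G slow steps each keep below (1 + delta)^(2G) f(n_k), and the
block of n_k is a run of length f(n_k). *)
Lemma longest_run_cvg :
  ((longest_run n x lambda)%:R / (f n)%:R : R) @[n --> \oo] --> (1 : R).
Proof.
apply/cvgrPdist_lt => e e0.
(* Chosen so that (1 + delta)^(2G) is at most 1 + e/2, by [expr1D_le]. *)
pose delta := Num.min (e / 2) 1 / 3 ^+ (G + G).
have min0 : 0 < Num.min (e / 2) 1 by rewrite lt_min ltr01 andbT divr_gt0.
have p3 : 1 <= 3 ^+ (G + G) :> R by rewrite exprn_ege1// ler1n.
have p30 : 0 < 3 ^+ (G + G) :> R by exact: lt_le_trans p3.
have delta0 : 0 < delta by rewrite divr_gt0.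
have delta1 : delta <= 1.
  by rewrite ler_pdivrMr// mul1r; apply: le_trans p3; rewrite ge_min lexx orbT.
have two_stages : (1 + delta) ^+ (G + G) <= 1 + e / 2.
  apply: le_trans (expr1D_le _ _) _; first by rewrite (ltW delta0).
  rewrite /delta mulrC divfK ?gt_eqF//.
  by rewrite lerD2l ge_min lexx.
have [_ _ f_unb /cvgrPdist_lt/(_ _ delta0)[m0 _ f_slow]] := f_adm.
have one_step m : (m0 <= m)%N -> (0 < m)%N ->
    (f (m + f m))%:R <= (1 + delta) * (f m)%:R :> R.
  move=> m0m mpos; have := f_slow m m0m => /=.
  rewrite ltr_norml => /andP[h _].
  have fm : 0 < (f m)%:R :> R by rewrite ltr0n f_gt0.
  by rewrite -ler_pdivrMr//; lra.
have steps m i : (m0 <= m)%N -> (0 < m)%N ->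
    (f (m + i * f m))%:R <= (1 + delta) ^+ i * (f m)%:R :> R.
  move=> m0m mpos; elim: i => [|i IH]; first by rewrite mul0n addn0 mul1r.
  apply: (@le_trans _ _ (f ((m + i * f m) + f (m + i * f m)))%:R).
    rewrite ler_nat; apply: f_homo; first lia.
    by have := f_homo mpos (leq_addr (i * f m) m); lia.
  apply: le_trans (one_step _ _ _) _; [lia|lia|].
  by rewrite exprS -mulrA; apply: ler_wpM2l => //; lra.
have stage_step k : (m0 <= k)%N ->
    (f (st k.+1))%:R <= (1 + delta) ^+ G * (f (st k))%:R :> R.
  move=> mk; apply: steps; last exact: stage_gt0.
  by apply: leq_trans mk _; exact: stage_ge.
have [n1 n1_gt0 n1_large] := f_unb (Num.Def.archi_bound (3 * N%:R / e)).
have large n : (n1 <= n)%N -> 3 * N%:R / e < (f n)%:R :> R.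
  move=> n1n; apply: lt_le_trans (archi_boundP _) _.
    by rewrite divr_ge0// ltW.
  by rewrite ler_nat; apply: leq_trans (ltnW n1_large) (f_homo _ _).
exists (maxn (st m0.+1) n1) => // n /=; rewrite geq_max => /andP[mn n1n].
have n0 : (0 < n)%N by apply: leq_trans n1n.
have fn0 : 0 < (f n)%:R :> R by rewrite ltr0n f_gt0.
have [k /andP[kn nk]] : exists k, (st k <= n < st k.+1)%N.
  apply: stage_exists => //; apply: leq_trans mn.
  exact: (@stage_homo f G start 0%N m0.+1).
have mk : (m0.+1 <= k)%N.
  rewrite -ltnS ltnNge; apply/negP => /(@stage_homo f G start) h.
  by have := leq_trans (leq_trans nk h) mn; rewrite ltnn.
case: k mk kn nk => // k mk kn nk.
have lower : (f n)%:R <= (1 + e / 2) * (longest_run n x lambda)%:R :> R.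
  apply: (@le_trans _ _ (f (st k.+2))%:R); first by rewrite ler_nat f_homo// ltnW.
  apply: le_trans (stage_step _ (leqW mk)) _.
  apply: (@le_trans _ _ ((1 + delta) ^+ (G + G) * (f (st k))%:R)).
    rewrite exprD -mulrA; apply: ler_wpM2l; last exact: stage_step.
    by apply: exprn_ge0; lra.
  apply: ler_pM => //; first by apply: exprn_ge0; lra.
  by rewrite ler_nat longest_run_stage_ge.
have upper : (longest_run n x lambda)%:R <= (f n)%:R + 3 * N%:R :> R.
  by rewrite -natrM -natrD ler_nat longest_run_pattern_le.
have := large n n1n; rewrite ltr_pdivrMr// => fn_large.
set L : R := (longest_run _ _ _)%:R in lower upper *.
have L0 : 0 <= L by [].
have -> : 1 - L / (f n)%:R = ((f n)%:R - L) / (f n)%:R.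
  by rewrite mulrBl divff// gt_eqF.
rewrite normrM normfV (gtr0_norm fn0) ltr_pdivrMr// ltr_norml.
apply/andP; split; first by nra.
have [Lf|fL] := leP L (f n)%:R; last by nra.
have : e / 2 * L <= e / 2 * (f n)%:R by apply: ler_wpM2l => //; lra.
by nra.
Qed.

Lemma pattern_longest_run_set : longest_run_set lambda f x.
Proof.
split.
- by rewrite ltW ?cf_value_gt0//= cf_value_lt1.
- exact: cf_value_irrational.
- exact: longest_run_cvg.
- by move=> n mu n0 _ ml; exact: longest_run_lt.
Qed.

End PatternDigits.

End Assembly.

Theorem theorem1 (R : realType) (lambda : nat) (f : nat -> nat)
  (lambda_gt0 : (0 < lambda)%N) (f_admissible : admissible R f) :
  hausdorff_dim (@longest_run_set R lambda f) = 1%E.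
Proof.
apply/eqP; rewrite eq_le; apply/andP; split.
  apply/lee_addgt0Pr => e e0; apply: ereal_inf_lbound => /=.
  exists (1 + e) => //; split; first by rewrite addr_ge0// ltW.
  apply: hausdorff_measure_eq0; first by rewrite ltrDl.
  by move=> x [/andP[x0 x1] _ _ _] /=; rewrite x0 ltW.
apply: le_ereal_inf_tmp => _ [s [s0 Hs] <-]; rewrite lee_fin leNgt.
apply/negP => s1.
have [M [G0 [BM G01 H]]] :
  _ := @restricted_digits_measure_neq0 R s lambda.+2 (introT andP (conj s0 s1)).
(* The blocks and the separators each have density at most 1/G, hence the
  factor 2. *)
pose G := (2 * G0)%N; pose N := (2 * G)%N.
have G1 : (1 < G)%N by rewrite /G; lia.
have [f_gt0 f_homo f_unb _] := f_admissible.
have [n1 n1_gt0 n1_large] := f_unb N.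
pose start := maxn n1 N.
have start_ge : (N <= start)%N by rewrite leq_maxr.
have f_start : (N <= f start)%N.
  by apply: leq_trans (ltnW n1_large) (f_homo _ _ n1_gt0 _); rewrite leq_maxl.
pose c := run_pattern lambda f G start.
apply: (H c (G * N + N)%N _ _ _ _ Hs) => [k|n|d dA].
- apply: leq_trans BM; rewrite /c /run_pattern /separator.
  case: ifP => _; first lia.
  case: ifP => _; first by case: ifP => _; lia.
  by case: ifP => _; lia.
- have := @forced_count_run_pattern lambda f G start f_gt0 G1 start_ge n.
  rewrite -/c -/N; set C := (G * N + N)%N; rewrite /G; lia.
have d0 k : (0 < d k)%N by exact: allowed_digits_gt0 (dA k).
apply: (@pattern_longest_run_set R lambda f G start) => // k ck.
have := dA k; rewrite /allowed_digits; case: eqP => // _.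
by rewrite inE => /eqP.
Qed.
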